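(* Let $(X,d)$ be a geometrically doubling metric space equipped with an upper doubling measure $\mu$, and let $\alpha,\beta>1$. If $B$ is an $(\alpha^3,\beta)$-doubling ball, then $B$, $\alpha B$ and $\alpha^2B$ are three consecutive $(\alpha,\beta)$-doubling balls, i.e. each of $B$, $\alpha B$, $\alpha^2B$ is $(\alpha,\beta)$-doubling.
   Context: $B(x,r)=\{y: d(y,x)<r\}$; for $B=B(x,r)$, $aB=B(x,ar)$. For $\alpha,\beta>1$, a ball $B$ is $(\alpha,\beta)$-doubling if $\mu(\alpha B)\le\beta\mu(B)$. Geometrically doubling: there is $N\in\mathbb{N}$ such that every ball $B(x,r)$ can be covered by at most $N$ balls of radius $r/2$. Upper doubling: $\mu$ is a Borel measure and there is $\lambda:X\times(0,\infty)\to(0,\infty)$ such that $r\mapsto\lambda(x,r)$ is increasing for each $x$; $\lambda(x,2r)\le C_\lambda\lambda(x,r)$; $\mu(B(x,r))\le\lambda(x,r)$; and $\lambda(x,r)\approx\lambda(y,r)$ (uniform constants) whenever $d(x,y)\le r$. *)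

(* Defs.v *)
From HB Require Import structures.
From mathcomp Require Import all_boot all_order all_algebra.
From mathcomp Require Import all_classical all_reals all_analysis.

Set Implicit Arguments.
Unset Strict Implicit.
Unset Printing Implicit Defensive.

Import Order.TTheory GRing.Theory Num.Theory.

Local Open Scope classical_set_scope.
Local Open Scope ring_scope.

(* Measurable types are pointed, so the underlying metric space has to be. *)
#[short(type="pmetricType")]
HB.structure Definition PointedMetric (K : numDomainType) :=
  { M of Metric K M & Pointed M }.

(* Measures on the sigma-algebra generated by the open sets of X. *)
Notation borel_measure R X :=
  {measure set (g_sigma_algebraType (@open X)) -> \bar R} (only parsing).

(* In a metricType, [ball x r] is the open ball [set y | mdist x y < r]
   (ballEmdist). As a set, a ball need not determine its centre and radius, so a
   "ball B" is given by the pair (x, r) with 0 < r, and a B by (x, a * r). *)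

Definition geometrically_doubling (R : realType) (X : metricType R) : Prop :=
  exists N : nat, forall (x : X) (r : R), 0 < r ->
    exists2 s : seq X, (size s <= N)%N &
      ball x r `<=` \bigcup_(y in [set` s]) ball y (r / 2).

(* The values of lambda at nonpositive radii are irrelevant; "increasing" is
   read as nondecreasing. *)
Definition upper_doubling (R : realType) (X : pmetricType R)
    (mu : borel_measure R X) : Prop :=
  exists (lambda : X -> R -> R) (Clambda C : R),
    0 < Clambda /\ 0 < C /\
    [/\ forall (x : X) (r : R), 0 < r -> 0 < lambda x r,
        forall (x : X) (r s : R), 0 < r -> r <= s -> lambda x r <= lambda x s,
        forall (x : X) (r : R), 0 < r ->
          lambda x (2 * r) <= Clambda * lambda x r,
        forall (x : X) (r : R), 0 < r -> (mu (ball x r) <= (lambda x r)%:E)%E &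
        forall (x y : X) (r : R), 0 < r -> mdist x y <= r ->
          C^-1 * lambda y r <= lambda x r <= C * lambda y r].

Definition doubling_ball (R : realType) (X : pmetricType R)
    (mu : borel_measure R X) (alpha beta : R) (x : X) (r : R) : Prop :=
  (mu (ball x (alpha * r)) <= beta%:E * mu (ball x r))%E.

(* Main.v *)
Require Import Defs.
From HB Require Import structures.
From mathcomp Require Import all_boot all_order all_algebra.
From mathcomp Require Import all_classical all_reals all_analysis.

Set Implicit Arguments.
Unset Strict Implicit.
Unset Printing Implicit Defensive.

Import Order.TTheory GRing.Theory Num.Theory.

Local Open Scope classical_set_scope.
Local Open Scope ring_scope.

(** For i = 0, 1, 2 the inclusions B ⊆ α^i B and α^(i+1) B ⊆ α^3 B hold because α ≥ 1. Monotonicity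
    of μ ([le_mu_ball]) then gives μ(α^(i+1) B) ≤ μ(α^3 B) ≤ β μ(B) ≤ β μ(α^i B).
    [doubling_ball_between] isolates this chain. *)

Lemma mball_open (R : realType) (X : metricType R) (x : X) (r : R) :
  open (ball x r).
Proof.
rewrite openE => y; rewrite ballEmdist /= => xy.
apply/nbhs_ballP; exists (r - mdist x y); rewrite /= ?subr_gt0// => z.
rewrite ballEmdist /= ltrBrDl => yz.
exact: le_lt_trans (metric_triangle _ _ _) yz.
Qed.

Lemma le_mu_ball (R : realType) (X : pmetricType R) (mu : borel_measure R X)
    (x : X) (r s : R) :
  r <= s -> (mu (ball x r) <= mu (ball x s))%E.
Proof.
have mball t : measurable (ball x t : set (g_sigma_algebraType (@open X))).
  by apply: sub_sigma_algebra; exact: mball_open.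
by move=> rs; apply: le_measure; rewrite ?inE//; exact: le_ball.
Qed.

(** Doubling with the large factor [c] passes to any intermediate ball whose [a]-dilate still fits
    in the [c]-dilate: the left side of the inequality shrinks and, as [beta] is nonnegative, the
    right side grows. *)
Lemma doubling_ball_between (R : realType) (X : pmetricType R)
    (mu : borel_measure R X) (a b c beta : R) (x : X) (r : R) :
  0 <= beta -> r <= b * r -> a * (b * r) <= c * r ->
  doubling_ball mu c beta x r -> doubling_ball mu a beta x (b * r).
Proof.
move=> beta0 rb abc; rewrite /doubling_ball => hc.
apply: (le_trans (le_mu_ball mu x abc)); apply: (le_trans hc).
by rewrite lee_wpmul2l ?lee_fin// le_mu_ball.
Qed.

Theorem proposition2p4 (R : realType) (X : pmetricType R)
    (mu : borel_measure R X)
    (hX : geometrically_doubling X) (hmu : upper_doubling mu)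
    (alpha beta : R) (halpha : 1 < alpha) (hbeta : 1 < beta)
    (x : X) (r : R) (hr : 0 < r)
    (hB : doubling_ball mu (alpha ^+ 3) beta x r) :
  [/\ doubling_ball mu alpha beta x r,
      doubling_ball mu alpha beta x (alpha * r) &
      doubling_ball mu alpha beta x (alpha ^+ 2 * r)].
Proof.
have a1 : 1 <= alpha := ltW halpha.
have between i : (i < 3)%N -> doubling_ball mu alpha beta x (alpha ^+ i * r).
  move=> i3; apply: doubling_ball_between hB.
  - exact: ltW (lt_trans ltr01 hbeta).
  - by rewrite ler_peMl ?(ltW hr)// exprn_ege1.
  (* The bound [i < 3] enters here, as i + 1 ≤ 3. *)
  - by rewrite mulrA -exprS ler_pM2r// ler_weXn2l.
split; [|exact: (between 1%N)|exact: between].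
(* [alpha ^+ 1] computes to [alpha], but [alpha ^+ 0 * r] has to be rewritten to [r]. *)
by have := between 0%N isT; rewrite expr0 mul1r.
Qed.
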